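(* Let $A$ be a proper unital $*$-ring such that $A_\Sigma\cap-A_\Sigma=\{0\}$ and $A_+A_+\cap A_{\mathrm{sa}}=A_+$. Suppose that $A_+=A_+^2$ and that, for all $a,b\in A_+$, $a^*a\preceq b^*b$ implies $a\preceq b$. Then $A_+A_+\cap-\mathfrak{r}=\{0\}$.
   Context: A $*$-ring is an associative ring with a map $a\mapsto a^*$ satisfying $a^{**}=a$, $(ab)^*=b^*a^*$, $(a+b)^*=a^*+b^*$; it is proper if $a^*a=0$ implies $a=0$. Unital means having a two-sided unit $1$. $A_{\mathrm{sa}}=\{a\in A:a=a^*\}$. $A_\Sigma$ is the set of all finite sums $\sum_{k=1}^n a_k^*a_k$ with $n\geq1$, $a_k\in A$. $A_+=\{a\in A:na\in A_\Sigma\text{ for some positive integer }n\}$. $\mathfrak{r}=\{a\in A:a+a^*\in A_+\}$, and $a\preceq b$ means $b-a\in\mathfrak{r}$. $A_+A_+=\{ab:a,b\in A_+\}$, while $A_+^2=\{a^2:a\in A_+\}$ is the set of squares of elements of $A_+$. $-\mathfrak{r}=\{-a:a\in\mathfrak{r}\}$. *)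

(* Defs.v *)
From mathcomp Require Import all_boot all_order all_algebra.
From mathcomp Require Import classical_sets.

Set Implicit Arguments.
Unset Strict Implicit.
Unset Printing Implicit Defensive.

Import GRing.Theory.
Local Open Scope classical_set_scope.
Local Open Scope ring_scope.

(* The carrier is a [pzRingType], so that the zero ring is not excluded. *)
Record is_star_ring (A : pzRingType) (star : A -> A) : Prop := IsStarRing {
  star_invol : forall a, star (star a) = a ;
  star_mul : forall a b, star (a * b) = star b * star a ;
  star_add : forall a b, star (a + b) = star a + star b }.

Definition proper_star (A : pzRingType) (star : A -> A) : Prop :=
  forall a, star a * a = 0 -> a = 0.

Definition self_adjoint (A : pzRingType) (star : A -> A) : set A :=
  [set a | a = star a].

Definition sums_of_squares (A : pzRingType) (star : A -> A) : set A :=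
  [set x | exists n : nat, (0 < n)%N /\
     exists a : 'I_n -> A, x = \sum_(k < n) star (a k) * a k].

Definition positive (A : pzRingType) (star : A -> A) : set A :=
  [set a | exists n : nat, (0 < n)%N /\ sums_of_squares star (a *+ n)].

(* The set usually denoted by a fraktur r. *)
Definition accretive (A : pzRingType) (star : A -> A) : set A :=
  [set a | positive star (a + star a)].

Definition preceq (A : pzRingType) (star : A -> A) (a b : A) : Prop :=
  accretive star (b - a).

Definition set_opp (A : pzRingType) (X : set A) : set A :=
  [set - x | x in X].

Definition set_mul (A : pzRingType) (X Y : set A) : set A :=
  [set x * y | x in X & y in Y].

(* Squares of elements of X only, as opposed to [set_mul X X]. *)
Definition set_sqr (A : pzRingType) (X : set A) : set A :=
  [set x ^+ 2 | x in X].

(* Main.v *)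
Require Import Defs.
From mathcomp Require Import all_boot all_order all_algebra.
From mathcomp Require Import classical_sets.
Import GRing.Theory.
Local Open Scope classical_set_scope.
Local Open Scope ring_scope.

Set Implicit Arguments.
Unset Strict Implicit.

(** Suppose [a] and [b] are positive and [ab + ba <= 0]. Put [y = a - b] and
    let [p] be the positive square root of [y^2]. Since
    [y^2 - (a + b)^2 = - 2 (ab + ba) >= 0], monotonicity of the square root
    gives [a + b <= p]. So the two elements [u = p - y] and [v = p + y], which
    are twice the negative and the positive part of [y], dominate [2b] and [2a]
    respectively. If moreover [p] commutes with [y], then
    [u v = p^2 - y^2 = 0]: the elements [a] and [b] lie under orthogonal
    elements, so they are orthogonal. In detail, [u a u] is positive and
    [2 u a u <= u v u = 0], so that [a u = 0]; then [2 a b a <= a u a = 0], so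
    that [b a = 0], and finally [a b = (b a)^* = 0].

    That [p] commutes with whatever self-adjoint element commutes with [p^2]
    is [comm_positive_sqrt]; it is the place where products of commuting
    positive elements have to be positive. The order is antisymmetric because
    the ring has no additive torsion ([mulrn_eq0_proper]), and vanishing of a
    conjugate [c^* p c] passes to [p c] because positive elements are squares
    and the involution is proper ([conj_positive_eq0]). *)

(** * The positive cone of a star-ring *)

Lemma star0 (A : pzRingType) (star : A -> A) :
  is_star_ring star -> star 0 = 0.
Proof.
by move=> [_ _ starD]; apply: (@addrI _ (star 0)); rewrite -starD !addr0.
Qed.

Lemma starN (A : pzRingType) (star : A -> A) (a : A) :
  is_star_ring star -> star (- a) = - star a.
Proof.
move=> hs; apply: (@addrI _ (star a)).
by rewrite -(star_add hs) !subrr (star0 hs).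
Qed.

Lemma sums_of_squares_sqr (A : pzRingType) (star : A -> A) (a : A) :
  sums_of_squares star (star a * a).
Proof. by exists 1%N; split=> //; exists (fun _ => a); rewrite big_ord1. Qed.

Lemma sums_of_squaresD (A : pzRingType) (star : A -> A) (x y : A) :
  sums_of_squares star x -> sums_of_squares star y ->
  sums_of_squares star (x + y).
Proof.
move=> [n [n_gt0 [a ->]]] [m [_ [b ->]]].
exists (n + m)%N; split; first by rewrite addn_gt0 n_gt0.
exists (fun i => match split i with inl j => a j | inr j => b j end).
rewrite big_split_ord /=; congr (_ + _); apply: eq_bigr => i _.
  by rewrite (unsplitK (inl _ i)).
by rewrite (unsplitK (inr _ i)).
Qed.

Lemma sums_of_squares0 (A : pzRingType) (star : A -> A) :
  sums_of_squares star 0.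
Proof. by rewrite -(mulr0 (star 0)); exact: sums_of_squares_sqr. Qed.

Lemma sums_of_squaresMn (A : pzRingType) (star : A -> A) (x : A) (n : nat) :
  sums_of_squares star x -> sums_of_squares star (x *+ n).
Proof.
move=> hx; elim: n => [|n IHn]; first exact: sums_of_squares0.
by rewrite mulrS; exact: sums_of_squaresD.
Qed.

Lemma sums_of_squares_conj (A : pzRingType) (star : A -> A) (c x : A) :
  is_star_ring star ->
  sums_of_squares star x -> sums_of_squares star (star c * x * c).
Proof.
move=> hs [n [n_gt0 [a ->]]]; exists n; split=> //.
exists (fun k => a k * c); rewrite mulr_sumr mulr_suml.
by apply: eq_bigr => k _; rewrite (star_mul hs) !mulrA.
Qed.

Lemma positive_sqr (A : pzRingType) (star : A -> A) (a : A) :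
  positive star (star a * a).
Proof. by exists 1%N; split=> //; exact: sums_of_squares_sqr. Qed.

Lemma positive0 (A : pzRingType) (star : A -> A) : positive star 0.
Proof. by rewrite -(mulr0 (star 0)); exact: positive_sqr. Qed.

Lemma positiveD (A : pzRingType) (star : A -> A) (x y : A) :
  positive star x -> positive star y -> positive star (x + y).
Proof.
move=> [n [n_gt0 hx]] [m [m_gt0 hy]]; exists (n * m)%N.
split; first by rewrite muln_gt0 n_gt0.
rewrite mulrnDl; apply: sums_of_squaresD.
  by rewrite mulrnA; exact: sums_of_squaresMn.
by rewrite mulnC mulrnA; exact: sums_of_squaresMn.
Qed.

Lemma positive_halve (A : pzRingType) (star : A -> A) (x : A) :
  positive star (x + x) -> positive star x.
Proof.
move=> [n [n_gt0 hx]]; exists (2 * n)%N.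
by split; [rewrite muln_gt0 | rewrite mulrnA].
Qed.

Lemma positive_conj (A : pzRingType) (star : A -> A) (c x : A) :
  is_star_ring star ->
  positive star x -> positive star (star c * x * c).
Proof.
move=> hs [n [n_gt0 hx]]; exists n; split=> //.
by rewrite -mulrnAl -mulrnAr; exact: sums_of_squares_conj.
Qed.

(** * Antisymmetry, squares and commutation *)

(** If [n a = 0] then [a^* a] and [- a^* a = (n - 1) a^* a] are both sums of
    squares. *)
Lemma mulrn_eq0_proper (A : pzRingType) (star : A -> A) (a : A) (n : nat) :
  proper_star star ->
  sums_of_squares star `&` set_opp (sums_of_squares star) = [set 0] ->
  (0 < n)%N -> a *+ n = 0 -> a = 0.
Proof.
move=> hproper hsigma; case: n => // n _ an0; apply: hproper.
have : [set 0] (star a * a); last by [].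
rewrite -hsigma; split; first exact: sums_of_squares_sqr.
exists (star a * a *+ n); first exact/sums_of_squaresMn/sums_of_squares_sqr.
by apply/eqP; rewrite eqr_oppLR -addr_eq0 -mulrSr -mulrnAr an0 mulr0.
Qed.

Lemma positive_anti (A : pzRingType) (star : A -> A) (x : A) :
  proper_star star ->
  sums_of_squares star `&` set_opp (sums_of_squares star) = [set 0] ->
  positive star x -> positive star (- x) -> x = 0.
Proof.
move=> hproper hsigma [n [n_gt0 hx]] [m [m_gt0 hNx]].
apply: (mulrn_eq0_proper (n := n * m) hproper hsigma).
  by rewrite muln_gt0 n_gt0.
have : [set 0] (x *+ (n * m)); last by [].
rewrite -hsigma; split; first by rewrite mulrnA; exact: sums_of_squaresMn.
exists ((- x) *+ m *+ n); first exact: sums_of_squaresMn.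
by rewrite -mulrnA mulNrn opprK mulnC.
Qed.

Lemma conj_positive_eq0 (A : pzRingType) (star : A -> A) (c p : A) :
  is_star_ring star -> proper_star star ->
  positive star `<=` self_adjoint star ->
  positive star = set_sqr (positive star) ->
  positive star p -> star c * p * c = 0 -> p * c = 0.
Proof.
move=> hs hproper hsa hsqr; rewrite hsqr => -[s /hsa s_sa <-].
rewrite expr2 => h; suff sc0 : s * c = 0 by rewrite -mulrA sc0 mulr0.
by apply: hproper; rewrite (star_mul hs) -s_sa mulrA -(mulrA (star c)).
Qed.

(** The commutator [k = y p - p y] is skew-adjoint and anticommutes with [p].
    Hence [k^* k] commutes with [p], so [k^* k p] is positive; but
    [k^* p k = - k^* k p] is positive too. Both vanish, which gives
    [p k = k p = 0], and then [k] is nilpotent because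
    [k (y p - p y) k = 0]. *)
Lemma comm_positive_sqrt (A : pzRingType) (star : A -> A) (p y : A) :
  is_star_ring star -> proper_star star ->
  sums_of_squares star `&` set_opp (sums_of_squares star) = [set 0] ->
  set_mul (positive star) (positive star) `&` self_adjoint star
    = positive star ->
  positive star = set_sqr (positive star) ->
  positive star p -> self_adjoint star y ->
  y * (p * p) = p * p * y -> y * p = p * y.
Proof.
move=> hs hproper hsigma hprod hsqr p_pos y_sa yp2.
have hsa : positive star `<=` self_adjoint star.
  by move=> x; rewrite -[in X in X -> _]hprod => -[].
have p_sa : star p = p by rewrite -(hsa _ p_pos).
have {y_sa} y_sa : star y = y by rewrite -y_sa.
apply/eqP; rewrite -subr_eq0; apply/eqP; set k := y * p - p * y.
have k_skew : star k = - k.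
  by rewrite (star_add hs) (starN _ hs) !(star_mul hs) p_sa y_sa opprB.
have kp : k * p = - (p * k).
  by rewrite mulrBl mulrBr -!mulrA yp2 !mulrA opprB.
have kkp : k * k * p = p * (k * k).
  by rewrite -mulrA kp mulrN mulrA kp mulNr opprK mulrA.
have kpk : star k * p * k = - (star k * k * p).
  by rewrite k_skew !mulNr opprK kkp kp mulNr opprK mulrA.
have hp_pos : positive star (star k * k * p).
  rewrite -hprod; split.
    by exists (star k * k); [exact: positive_sqr | exists p].
  rewrite /self_adjoint /= !(star_mul hs) p_sa (star_invol hs) k_skew.
  by rewrite !mulNr mulrN kkp.
have hp0 : star k * k * p = 0.
  apply: (positive_anti hproper hsigma hp_pos).
  by rewrite -kpk; exact: positive_conj.
have pk0 : p * k = 0.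
  by apply: conj_positive_eq0 hsqr p_pos _ => //; rewrite kpk hp0 oppr0.
have kp0 : k * p = 0 by rewrite kp pk0 oppr0.
have kkk0 : k * k * k = 0.
  rewrite -[k * k * k]/(k * (y * p - p * y) * k).
  move: (k) pk0 kp0 => c pc0 cp0; rewrite mulrBr mulrBl -!mulrA pc0.
  by rewrite !mulr0 mulrA cp0 mul0r subr0.
have kk0 : k * k = 0.
  apply: hproper; rewrite (star_mul hs) k_skew mulrNN.
  by rewrite mulrA kkk0 mul0r.
by apply: hproper; rewrite k_skew mulNr kk0 oppr0.
Qed.

(** * Orthogonality of positive elements *)

(** Conjugation by [u] kills the upper bound [v] of [2a], so that [a u = 0],
    and then conjugation by [a] kills the upper bound [u] of [2b]. The bounded
    elements are doubled because the ring may contain no halves. *)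
Lemma orthogonal_below (A : pzRingType) (star : A -> A) (a b u v : A) :
  is_star_ring star -> proper_star star ->
  sums_of_squares star `&` set_opp (sums_of_squares star) = [set 0] ->
  positive star `<=` self_adjoint star ->
  positive star = set_sqr (positive star) ->
  positive star a -> positive star b -> self_adjoint star u ->
  positive star (v - (a + a)) -> positive star (u - (b + b)) ->
  u * v = 0 -> a * b = 0.
Proof.
move=> hs hproper hsigma hsa hsqr a_pos b_pos u_sa hav hbu uv0.
(* Conjugating by [c] gives [2 c x c <= 0], while [c x c] is positive. *)
have kill x w c : positive star x -> self_adjoint star c ->
    positive star (w - (x + x)) -> c * w * c = 0 -> x * c = 0.
  move=> x_pos c_sa hxw cwc0.
  have := positive_conj c hs hxw; have := positive_conj c hs x_pos.
  rewrite -c_sa mulrBr mulrBl cwc0 sub0r mulrDr mulrDl opprD.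
  move=> h /positive_halve hN.
  apply: conj_positive_eq0 hsqr x_pos _ => //; rewrite -c_sa.
  exact: positive_anti hproper hsigma h hN.
have au0 : a * u = 0 by apply: kill hav _ => //; rewrite uv0 mul0r.
have ba0 : b * a = 0.
  by apply: kill hbu _ => //; [exact: hsa | rewrite au0 mul0r].
by rewrite (hsa _ a_pos) (hsa _ b_pos) -(star_mul hs) ba0 (star0 hs).
Qed.

Unset Implicit Arguments.
Set Strict Implicit.

Theorem theorem3 (A : pzRingType) (star : A -> A)
  (hstar : is_star_ring star)
  (hproper : proper_star star)
  (hsigma : sums_of_squares star `&` set_opp (sums_of_squares star) = [set 0])
  (hprod : set_mul (positive star) (positive star) `&` self_adjoint star
             = positive star)
  (hsqr : positive star = set_sqr (positive star))
  (hmono : forall a b : A, positive star a -> positive star b ->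
     preceq star (star a * a) (star b * b) -> preceq star a b) :
  set_mul (positive star) (positive star) `&` set_opp (accretive star)
    = [set 0].
Proof.
have hsa : positive star `<=` self_adjoint star.
  by move=> x; rewrite -[in X in X -> _]hprod => -[].
apply/seteqP; split=> [x | _ ->]; last first.
  split.
    exists 0; first exact: positive0.
    by exists 0; [exact: positive0 | rewrite mulr0].
  exists 0; last exact: oppr0.
  by rewrite /accretive /= (star0 hstar) addr0; exact: positive0.
move=> [[a a_pos [b b_pos <-]] [z z_acc zE]] /=.
have a_sa : star a = a by rewrite -(hsa _ a_pos).
have b_sa : star b = b by rewrite -(hsa _ b_pos).
have ab_neg : positive star (- (a * b + b * a)).
  have -> : b * a = star (a * b) by rewrite (star_mul hstar) a_sa b_sa.
  by rewrite -zE (starN _ hstar) -opprD opprK.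
pose y := a - b.
have y_sa : star y = y by rewrite (star_add hstar) (starN _ hstar) a_sa b_sa.
have [p p_pos p2] : set_sqr (positive star) (y * y).
  by rewrite -hsqr -{1}y_sa; exact: positive_sqr.
have p_sa : star p = p by rewrite -(hsa _ p_pos).
rewrite expr2 in p2.
have yp : y * p = p * y.
  by apply: (@comm_positive_sqrt _ star) => //; rewrite p2 mulrA.
have ab_le_p : positive star (p - (a + b)).
  have ab_sa : star (a + b) = a + b by rewrite (star_add hstar) a_sa b_sa.
  have : preceq star (a + b) p.
    apply: hmono => //; first exact: positiveD.
    rewrite ab_sa p_sa p2 /preceq /accretive /=.
    have -> : y * y - (a + b) * (a + b)
              = - (a * b + b * a) + - (a * b + b * a).
      have -> : y * y = (a * a + b * b) - (a * b + b * a).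
        by rewrite mulrBl !mulrBr opprB addrACA -opprD.
      have -> : (a + b) * (a + b) = (a * a + b * b) + (a * b + b * a).
        by rewrite mulrDl !mulrDr (addrC (b * a)) addrACA.
      by rewrite (opprD (a * a + b * b)) addrACA subrr add0r.
    rewrite (star_add hstar) (starN _ hstar) (star_add hstar).
    rewrite !(star_mul hstar) a_sa b_sa (addrC (b * a)).
    by do !apply: positiveD.
  rewrite /preceq /accretive /= (star_add hstar) (starN _ hstar) ab_sa p_sa.
  exact: positive_halve.
apply: (@orthogonal_below _ star a b (p - y) (p + y)) => //.
- by rewrite /self_adjoint /= (star_add hstar) (starN _ hstar) p_sa y_sa.
- suff -> : p + y - (a + a) = p - (a + b) by [].
  rewrite -addrA; congr (p + _).
  by rewrite opprD addrACA subrr add0r addrC -opprD.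
- suff -> : p - y - (b + b) = p - (a + b) by [].
  rewrite opprB -addrA; congr (p + _).
  by rewrite opprD addrACA subrr add0r -opprD.
- by rewrite mulrBl (mulrDr p p) (mulrDr y p) yp p2 (addrC (p * y)) subrr.
Qed.
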